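(* Let $M$ be a connected Riemannian manifold, $\mathcal E_j$ a Riemannian vector bundle over $M$ with linear connection $\nabla^j$, $j\in\{1,2\}$, and $F\in\Gamma(\mathrm{Hom}(\mathcal E_1,\mathcal E_2))$. If $F$ is recurrent then $F$ is semi-parallel, i.e. $\bar R\cdot F=0$.
   Context: $\Gamma(\mathcal V)$ denotes the space of cross sections of a vector bundle $\mathcal V$ over $M$, and $\Omega^1(M)$ the space of 1-forms on $M$. A Riemannian vector bundle is a vector bundle with a fiber metric; the fiber metrics on $\mathcal E_1$ and $\mathcal E_2$, as well as the one induced on $\mathrm{Hom}(\mathcal E_1,\mathcal E_2)$, are all denoted $\langle\,,\rangle$. $\mathrm{Hom}(\mathcal E_1,\mathcal E_2)\cong\mathcal E_1^*\otimes\mathcal E_2$ is the vector bundle of homomorphisms from $\mathcal E_1$ into $\mathcal E_2$. The connections $\nabla^1$ and $\nabla^2$ induce on $\mathrm{Hom}(\mathcal E_1,\mathcal E_2)$ a connection $\bar\nabla$ given by $$(\bar\nabla_XF)V=(\bar\nabla F)(V;X)=\nabla^2_X(FV)-F(\nabla^1_XV)$$ for any $X\in\Gamma(TM)$, $V\in\Gamma(\mathcal E_1)$ and $F\in\Gamma(\mathrm{Hom}(\mathcal E_1,\mathcal E_2))$. A section $F$ of $\mathrm{Hom}(\mathcal E_1,\mathcal E_2)$ is said to be recurrent if there exists $\tau\in\Omega^1(M)$ such that $\bar\nabla F=F\otimes\tau$, i.e. $\bar\nabla_XF=\tau(X)F$ for all $X\in\Gamma(TM)$ (parallelism is the special case $\tau=0$).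 Let $\bar R$, $R^1$ and $R^2$ be the curvature tensors corresponding to $\bar\nabla$, $\nabla^1$ and $\nabla^2$ respectively. Then $$(\bar R\cdot F)(V;X,Y)=(\bar R(X,Y)F)V=R^2(X,Y)FV-FR^1(X,Y)V$$ for any $X,Y\in\Gamma(TM)$, $V\in\Gamma(\mathcal E_1)$. $F$ is semi-parallel if $\bar R\cdot F=0$.
   Formalization: The linear connections ∇^1 and ∇^2 are assumed compatible with the fiber metrics of E_1 and E_2; for arbitrary linear connections the claim fails (trivial line bundles over R^2, ∇^1 = d, ∇^2 = d + x dy, F = identity). *)

(* Defs.v *)
From HB Require Import structures.
From mathcomp Require Import all_boot all_order all_algebra.
From mathcomp Require Import all_classical all_reals topology normedtype derive.
From mathcomp Require Import ssrAC ring.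
Set Implicit Arguments.
Unset Strict Implicit.
Unset Printing Implicit Defensive.
Import Order.TTheory GRing.Theory Num.Theory.
Import numFieldNormedType.Exports.
Local Open Scope classical_set_scope.
Local Open Scope ring_scope.

Section euclidean.
Variables (R : realType) (n : nat).
Implicit Types (U : set 'rV[R]_n) (f g : 'rV[R]_n -> R).

(* Only meant for open U: continuity and partial derivatives at the points of
   U are those of the ambient space. *)
Fixpoint Ck (k : nat) U f : Prop :=
  (forall x, U x -> {for x, continuous f}) /\
  if k is k'.+1 then
    forall i : 'I_n, (forall x, U x -> derivable f x (delta_mx 0 i)) /\
                     Ck k' U ('D_(delta_mx 0 i) f)
  else True.

Definition Cinfty U f : Prop := forall k, Ck k U f.

Lemma Ck_point k U f : (forall x, U x -> Ck k [set x] f) -> Ck k U f.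
Proof.
elim: k f => [|k IH] f H /=.
  by split => // x Ux; have [+ _] := H x Ux; exact.
split=> [x Ux|i]; first by have [+ _] := H x Ux; exact.
split=> [x Ux|]; first by have [_ /(_ i)[+ _]] := H x Ux; exact.
by apply: IH => x Ux; have [_ /(_ i)[]] := H x Ux.
Qed.

Lemma Ck_sub k U U' f : U' `<=` U -> Ck k U f -> Ck k U' f.
Proof.
move=> s; elim: k f => [|k IH] f /= [H1 H2].
  by split => // x /s; exact: H1.
split=> [x /s|i]; first exact: H1.
have [H3 H4] := H2 i; split => [x /s|]; [exact: H3|exact: IH].
Qed.

Lemma CkW k U f : Ck k.+1 U f -> Ck k U f.
Proof.
elim: k f => [|k IH] f [H1 H2]; first by split.
by split => // i; have [H3 H4] := H2 i; split => //; apply: IH.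
Qed.

Lemma Ck_ext k U f g : open U -> (forall x, U x -> f x = g x) ->
  Ck k U f -> Ck k U g.
Proof.
move=> oU.
have nfg f' g' : (forall x, U x -> f' x = g' x) ->
    forall x, U x -> \forall y \near x, f' y = g' y.
  by move=> fg x Ux; move: oU; rewrite openE => /(_ _ Ux); apply: filterS.
have cg f' g' : (forall x, U x -> f' x = g' x) ->
    (forall x, U x -> {for x, continuous f'}) ->
    forall x, U x -> {for x, continuous g'}.
  move=> fg H x Ux; rewrite /prop_for /continuous_at -(fg _ Ux).
  exact: cvg_trans (near_eq_cvg (F := nbhs x) (nfg _ _ fg x Ux)) (H x Ux).
elim: k f g => [|k IH] f g fg [H1 H2]; (split; first exact: cg fg H1) => //.
move=> i; have [H3 H4] := H2 i.
split=> [x Ux|].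
  by apply: near_eq_derivable (H3 x Ux); exact: nfg.
by apply: IH H4 => x Ux; apply: near_eq_derive; exact: nfg.
Qed.

Lemma Ck_cst k U (a : R) : Ck k U (cst a).
Proof.
elim: k a => [|k IH] a /=; (split; first by move=> x _; exact: cst_continuous) => //.
move=> i; split; first by move=> x _; exact: derivable_cst.
by rewrite (_ : 'D__ _ = cst 0) //; apply/funext => x; rewrite derive_cst.
Qed.

Lemma CkD k U f g : open U -> Ck k U f -> Ck k U g -> Ck k U (f + g).
Proof.
move=> oU; elim: k f g => [|k IH] f g [f1 f2] [g1 g2] /=;
  (split; first by move=> x Ux; exact: continuousD (f1 x Ux) (g1 x Ux)) => //.
move=> i; have [f3 f4] := f2 i; have [g3 g4] := g2 i; split.
  by move=> x Ux; apply: derivableD; [exact: f3|exact: g3].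
apply: (Ck_ext (f := 'D_(delta_mx 0 i) f + 'D_(delta_mx 0 i) g)) => //.
  by move=> x Ux; rewrite deriveD //; [exact: f3|exact: g3].
exact: IH.
Qed.

Lemma CkM k U f g : open U -> Ck k U f -> Ck k U g -> Ck k U (f * g).
Proof.
move=> oU; elim: k f g => [|k IH] f g fk gk; have [f1 f2] := fk;
  have [g1 g2] := gk;
  (split; first by move=> x Ux; exact: continuousM (f1 x Ux) (g1 x Ux)) => //.
move=> i; have [f3 f4] := f2 i; have [g3 g4] := g2 i; split.
  by move=> x Ux; apply: derivableM; [exact: f3|exact: g3].
apply: (Ck_ext (f := f * 'D_(delta_mx 0 i) g + g * 'D_(delta_mx 0 i) f)) => //.
  by move=> x Ux; rewrite deriveM //; [exact: f3|exact: g3].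
by apply: CkD => //; apply: IH => //; exact: CkW.
Qed.

End euclidean.

(* chart_map and chart_inv are total; only their restrictions to chart_dom and
   chart_img matter. *)
Record chart (R : realType) (n : nat) (T : topologicalType) := Chart {
  chart_dom : set T;
  chart_img : set 'rV[R]_n;
  chart_map : T -> 'rV[R]_n;
  chart_inv : 'rV[R]_n -> T;
  chart_dom_open : open chart_dom;
  chart_img_open : open chart_img;
  chart_mapP : forall p, chart_dom p -> chart_img (chart_map p);
  chart_invP : forall x, chart_img x -> chart_dom (chart_inv x);
  chart_mapK : forall p, chart_dom p -> chart_inv (chart_map p) = p;
  chart_invK : forall x, chart_img x -> chart_map (chart_inv x) = x;
  chart_map_cont : forall p, chart_dom p -> {for p, continuous chart_map};
  chart_inv_cont : forall x, chart_img x -> {for x, continuous chart_inv}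
}.

(* The chart image of the part of U covered by c. *)
Definition chart_set (R : realType) n (T : topologicalType) (c : chart R n T)
    (U : set T) : set 'rV[R]_n :=
  [set x | chart_img c x /\ U (chart_inv c x)].

Record manifold (R : realType) (n : nat) := Manifold {
  mcarrier :> topologicalType;
  m_hausdorff : hausdorff_space mcarrier;
  m_second_countable : @second_countable mcarrier;
  m_atlas : set (chart R n mcarrier);
  m_atlas_cover : forall p, exists2 c, m_atlas c & chart_dom c p;
  m_atlas_smooth : forall c d, m_atlas c -> m_atlas d ->
    forall i : 'I_n, Cinfty (chart_set c (chart_dom d))
                            (fun x => chart_map d (chart_inv c x) 0 i)
}.

Section smooth_on.
Variables (R : realType) (n : nat) (M : manifold R n).
Implicit Types (U : set M) (f g : M -> R).

Definition smooth_on U f : Prop :=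
  forall c, m_atlas c -> Cinfty (chart_set c U) (f \o chart_inv c).

Lemma chart_set_open (c : chart R n M) U : open U -> open (chart_set c U).
Proof.
move=> oU; rewrite openE => x [cx Ux]; apply: filterI.
  by have := @chart_img_open _ _ _ c; rewrite openE; exact.
by apply: (chart_inv_cont cx); move: oU; rewrite openE; exact.
Qed.

Lemma smooth_on_sub U U' f : U' `<=` U -> smooth_on U f -> smooth_on U' f.
Proof.
move=> s H c ac k; apply: Ck_sub (H c ac k).
by move=> x [? /s]; split.
Qed.

Lemma smooth_on_ext U f g : open U -> (forall p, U p -> f p = g p) ->
  smooth_on U f -> smooth_on U g.
Proof.
move=> oU fg H c ac k; apply: Ck_ext (H c ac k); first exact: chart_set_open.
by move=> x [_ /fg].
Qed.

Lemma smooth_on_local U f :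
  (forall p, U p -> exists2 U', U' p & smooth_on (U `&` U') f) -> smooth_on U f.
Proof.
move=> H c ac k; apply: Ck_point => x [cx Ux].
have [U' U'x /(_ c ac k)] := H _ Ux.
by apply: Ck_sub => _ ->.
Qed.

Lemma smooth_on_cst U (a : R) : smooth_on U (cst a).
Proof. by move=> c _ k; exact: Ck_cst. Qed.

Lemma smooth_onD U f g : open U ->
  smooth_on U f -> smooth_on U g -> smooth_on U (f + g).
Proof.
move=> oU Hf Hg c ac k.
by apply: CkD; [exact: chart_set_open|exact: Hf|exact: Hg].
Qed.

Lemma smooth_onM U f g : open U ->
  smooth_on U f -> smooth_on U g -> smooth_on U (f * g).
Proof.
move=> oU Hf Hg c ac k.
by apply: CkM; [exact: chart_set_open|exact: Hf|exact: Hg].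
Qed.

Lemma smooth_onN U f : open U -> smooth_on U f -> smooth_on U (- f).
Proof.
move=> oU Hf; rewrite -mulN1r; apply: smooth_onM => //.
exact: (@smooth_on_cst U (-1)).
Qed.

Lemma smooth_on_sum U (I : Type) (r : seq I) (P : pred I) (F : I -> M -> R) :
  open U -> (forall i, smooth_on U (F i)) ->
  smooth_on U (fun p => \sum_(i <- r | P i) F i p).
Proof.
move=> oU H; rewrite (_ : (fun _ => _) = \sum_(i <- r | P i) F i).
  elim/big_rec: _ => [|i f _ Hf]; first exact: smooth_on_cst.
  exact: smooth_onD.
by apply/funext => p; elim/big_rec2: _ => // i a b _ ->.
Qed.

Record smooth_fun := SmoothFun {
  sf_val :> M -> R;
  sf_smooth : smooth_on setT sf_val
}.

Lemma sf_inj (f g : smooth_fun) : sf_val f = sf_val g -> f = g.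
Proof.
by case: f g => f ? [g ?] /= fg; subst g; congr SmoothFun; exact: Prop_irrelevance.
Qed.

End smooth_on.

Section smooth_fun_ring.
Variables (R : realType) (n : nat) (M : manifold R n).
Local Notation C := (smooth_fun M).
Implicit Types f g h : C.

HB.instance Definition _ := gen_eqMixin C.
HB.instance Definition _ := gen_choiceMixin C.

Definition sf_cst (a : R) : C := SmoothFun (smooth_on_cst (M := M) setT a).
Definition sf_add f g : C :=
  SmoothFun (smooth_onD openT (sf_smooth f) (sf_smooth g)).
Definition sf_opp f : C := SmoothFun (smooth_onN openT (sf_smooth f)).
Definition sf_mul f g : C :=
  SmoothFun (smooth_onM openT (sf_smooth f) (sf_smooth g)).

Let addA : associative sf_add.
Proof. by move=> f g h; apply: sf_inj; exact: addrA. Qed.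
Let addC : commutative sf_add.
Proof. by move=> f g; apply: sf_inj; exact: addrC. Qed.
Let add0 : left_id (sf_cst 0) sf_add.
Proof. by move=> f; apply: sf_inj; exact: add0r. Qed.
Let addN : left_inverse (sf_cst 0) sf_opp sf_add.
Proof. by move=> f; apply: sf_inj; exact: addNr. Qed.

HB.instance Definition _ := GRing.isZmodule.Build C addA addC add0 addN.

Let mulA : associative sf_mul.
Proof. by move=> f g h; apply: sf_inj; exact: mulrA. Qed.
Let mulC : commutative sf_mul.
Proof. by move=> f g; apply: sf_inj; exact: mulrC. Qed.
Let mul1 : left_id (sf_cst 1) sf_mul.
Proof. by move=> f; apply: sf_inj; exact: mul1r. Qed.
Let mul1' : right_id (sf_cst 1) sf_mul.
Proof. by move=> f; apply: sf_inj; exact: mulr1. Qed.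
Let mulDl : left_distributive sf_mul +%R.
Proof. by move=> f g h; apply: sf_inj; exact: mulrDl. Qed.
Let mulDr : right_distributive sf_mul +%R.
Proof. by move=> f g h; apply: sf_inj; exact: mulrDr. Qed.

HB.instance Definition _ :=
  GRing.Zmodule_isPzRing.Build C mulA mul1 mul1' mulDl mulDr.
HB.instance Definition _ := GRing.PzRing_hasCommutativeMul.Build C mulC.

Lemma sfDE f g p : (f + g) p = f p + g p. Proof. by []. Qed.
Lemma sfNE f p : (- f) p = - f p. Proof. by []. Qed.
Lemma sfME f g p : (f * g) p = f p * g p. Proof. by []. Qed.
Lemma sf_cstE a p : sf_cst a p = a. Proof. by []. Qed.
Lemma sfP f g : (forall p, f p = g p) -> f = g.
Proof. by move=> fg; apply: sf_inj; apply/funext. Qed.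

End smooth_fun_ring.

Definition derivation_at (R : realType) n (M : manifold R n) (p : M)
    (v : smooth_fun M -> R) : Prop :=
  [/\ forall f g, v (f + g) = v f + v g,
      forall a f, v (sf_cst M a * f) = a * v f
    & forall f g, v (f * g) = f p * v g + g p * v f].

Record tangent (R : realType) n (M : manifold R n) (p : M) := Tangent {
  tv :> smooth_fun M -> R;
  tvP : derivation_at p tv
}.

Section tangent_space.
Variables (R : realType) (n : nat) (M : manifold R n) (p : M).
Local Notation T := (tangent p).
Implicit Types u v w : T.

Lemma tv_inj u v : tv u = tv v -> u = v.
Proof.
case: u v => u ? [v ?] /= uv; subst v.
by congr Tangent; exact: Prop_irrelevance.
Qed.

HB.instance Definition _ := gen_eqMixin T.
HB.instance Definition _ := gen_choiceMixin T.

Lemma tvD v f g : v (f + g) = v f + v g. Proof. by case: (tvP v). Qed.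
Lemma tvZ v a f : v (sf_cst M a * f) = a * v f. Proof. by case: (tvP v). Qed.
Lemma tvM v f g : v (f * g) = f p * v g + g p * v f.
Proof. by case: (tvP v). Qed.

Let zeroP : derivation_at p (fun=> 0).
Proof. by split=> *; rewrite ?mulr0 ?addr0. Qed.
Let addP u v : derivation_at p (fun f => u f + v f).
Proof. by split=> *; rewrite ?tvD ?tvZ ?tvM; ring. Qed.
Let scaleP a u : derivation_at p (fun f => a * u f).
Proof. by split=> *; rewrite ?tvD ?tvZ ?tvM; ring. Qed.

Definition tv_zero : T := Tangent zeroP.
Definition tv_add u v : T := Tangent (addP u v).
Definition tv_scale (a : R) u : T := Tangent (scaleP a u).
Definition tv_opp u : T := tv_scale (-1) u.

Let addA : associative tv_add.
Proof. by move=> u v w; apply: tv_inj; apply/funext => f /=; rewrite addrA. Qed.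
Let addC : commutative tv_add.
Proof. by move=> u v; apply: tv_inj; apply/funext => f /=; rewrite addrC. Qed.
Let add0 : left_id tv_zero tv_add.
Proof. by move=> u; apply: tv_inj; apply/funext => f /=; rewrite add0r. Qed.
Let addN : left_inverse tv_zero tv_opp tv_add.
Proof. by move=> u; apply: tv_inj; apply/funext => f /=; rewrite mulN1r addNr. Qed.

HB.instance Definition _ := GRing.isZmodule.Build T addA addC add0 addN.

Let scaleA a b v : tv_scale a (tv_scale b v) = tv_scale (a * b) v.
Proof. by apply: tv_inj; apply/funext => f /=; rewrite mulrA. Qed.
Let scale1 : left_id 1 tv_scale.
Proof. by move=> u; apply: tv_inj; apply/funext => f /=; rewrite mul1r. Qed.
Let scaleDr : right_distributive tv_scale +%R.
Proof. by move=> a u v; apply: tv_inj; apply/funext => f /=; rewrite mulrDr. Qed.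
Let scaleDl v : {morph tv_scale^~ v : a b / a + b}.
Proof. by move=> a b; apply: tv_inj; apply/funext => f /=; rewrite mulrDl. Qed.

HB.instance Definition _ :=
  GRing.Zmodule_isLmodule.Build R T scaleA scale1 scaleDr scaleDl.

Lemma tvDE u v f : (u + v) f = u f + v f. Proof. by []. Qed.
Lemma tvZE a u f : (a *: u) f = a * u f. Proof. by []. Qed.

End tangent_space.

Record vector_field (R : realType) n (M : manifold R n) := VectorField {
  vf_val :> forall p : M, tangent p;
  vf_smooth : forall f, smooth_on setT (fun p => vf_val p f)
}.

Section vector_fields.
Variables (R : realType) (n : nat) (M : manifold R n).
Local Notation C := (smooth_fun M).
Local Notation VF := (vector_field M).
Implicit Types (X Y Z : VF) (f g : C).

Definition vf_app X f : C := SmoothFun (vf_smooth X f).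

Lemma vf_inj X Y : (forall p, X p = Y p) -> X = Y.
Proof.
case: X Y => X ? [Y ?] /= XY.
have {}XY : X = Y by exact: functional_extensionality_dep.
subst Y.
by congr VectorField; exact: Prop_irrelevance.
Qed.

HB.instance Definition _ := gen_eqMixin VF.
HB.instance Definition _ := gen_choiceMixin VF.

Let zeroP f : smooth_on setT (fun p : M => (0 : tangent p) f).
Proof. exact: smooth_on_cst. Qed.
Let addP X Y f : smooth_on setT (fun p => (X p + Y p) f).
Proof. exact: sf_smooth (vf_app X f + vf_app Y f). Qed.
Let scaleP g X f : smooth_on setT (fun p => (g p *: X p) f).
Proof. exact: sf_smooth (g * vf_app X f). Qed.

Definition vf_zero : VF := VectorField zeroP.
Definition vf_add X Y : VF := VectorField (addP X Y).
Definition vf_scale g X : VF := VectorField (scaleP g X).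
Definition vf_opp X : VF := vf_scale (- 1) X.

Let addA : associative vf_add.
Proof. by move=> X Y Z; apply: vf_inj => p; exact: addrA. Qed.
Let addC : commutative vf_add.
Proof. by move=> X Y; apply: vf_inj => p; exact: addrC. Qed.
Let add0 : left_id vf_zero vf_add.
Proof. by move=> X; apply: vf_inj => p; exact: add0r. Qed.
Let addN : left_inverse vf_zero vf_opp vf_add.
Proof.
by move=> X; apply: vf_inj => p; rewrite -[RHS](addNr (X p)) -scaleN1r.
Qed.

HB.instance Definition _ := GRing.isZmodule.Build VF addA addC add0 addN.

Let scaleA f g X : vf_scale f (vf_scale g X) = vf_scale (f * g) X.
Proof. by apply: vf_inj => p; exact: scalerA. Qed.
Let scale1 : left_id 1 vf_scale.
Proof. by move=> X; apply: vf_inj => p; exact: scale1r. Qed.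
Let scaleDr : right_distributive vf_scale +%R.
Proof. by move=> f X Y; apply: vf_inj => p; exact: scalerDr. Qed.
Let scaleDl X : {morph vf_scale^~ X : f g / f + g}.
Proof. by move=> f g; apply: vf_inj => p; exact: scalerDl. Qed.

HB.instance Definition _ :=
  GRing.Zmodule_isLmodule.Build C VF scaleA scale1 scaleDr scaleDl.

Lemma vfDE X Y p : (X + Y) p = X p + Y p. Proof. by []. Qed.
Lemma vfZE f X p : (f *: X) p = f p *: X p. Proof. by []. Qed.
Lemma vf_appD X f g : vf_app X (f + g) = vf_app X f + vf_app X g.
Proof. by apply: sfP => p; exact: tvD. Qed.
Lemma vf_appZ X a f : vf_app X (sf_cst M a * f) = sf_cst M a * vf_app X f.
Proof. by apply: sfP => p; exact: tvZ. Qed.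
Lemma vf_appM X f g : vf_app X (f * g) = f * vf_app X g + g * vf_app X f.
Proof. by apply: sfP => p; exact: tvM. Qed.

Let lie_atP X Y p :
  derivation_at p (fun f => X p (vf_app Y f) - Y p (vf_app X f)).
Proof.
split=> *; rewrite ?vf_appD ?vf_appZ ?vf_appM ?tvD ?tvZ ?tvM /=; ring.
Qed.
Let lieP X Y f : smooth_on setT (fun p => Tangent (lie_atP X Y p) f).
Proof.
exact: sf_smooth (vf_app X (vf_app Y f) - vf_app Y (vf_app X f)).
Qed.

Definition lie X Y : VF := VectorField (lieP X Y).

End vector_fields.

Record one_form (R : realType) n (M : manifold R n) := OneForm {
  of_val :> forall p : M, tangent p -> R;
  of_lin : forall p a (u v : tangent p),
    of_val (a *: u + v) = a * of_val u + of_val v;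
  of_smooth : forall X : vector_field M, smooth_on setT (fun p => of_val (X p))
}.
Arguments of_val {R n M} _ p _.

Definition of_app R n (M : manifold R n) (tau : one_form M)
  (X : vector_field M) : smooth_fun M := SmoothFun (of_smooth tau X).

Definition inner_product (R : realType) (V : lmodType R) (g : V -> V -> R) :=
  [/\ forall a u v w, g (a *: u + v) w = a * g u w + g v w,
      forall u v, g u v = g v u
    & forall u, u != 0 -> 0 < g u u].

Record riemannian_metric (R : realType) n (M : manifold R n) :=
  RiemannianMetric {
  rm_val :> forall p : M, tangent p -> tangent p -> R;
  rm_inner : forall p, inner_product (@rm_val p);
  rm_smooth : forall X Y : vector_field M,
    smooth_on setT (fun p => rm_val (X p) (Y p))
}.
Arguments rm_val {R n M} _ p _ _.

(* triv_map and triv_inv are total in the base point; only their values over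
   triv_dom matter. *)
Record triv (R : realType) n (M : manifold R n) (E : M -> vectType R)
    (r : nat) := Triv {
  triv_dom : set M;
  triv_dom_open : open triv_dom;
  triv_map : forall p, {linear E p -> 'rV[R]_r};
  triv_inv : forall p, {linear 'rV[R]_r -> E p};
  triv_mapK : forall p, triv_dom p -> cancel (triv_map p) (triv_inv p);
  triv_invK : forall p, triv_dom p -> cancel (triv_inv p) (triv_map p)
}.

(* A vector bundle is given by its fibers and a bundle atlas: the smooth
   structure on the total space is the one determined by the local
   trivializations, whose transition matrices are smooth. *)
Record vbundle (R : realType) n (M : manifold R n) := VBundle {
  vb_fiber :> M -> vectType R;
  vb_rank : nat;
  vb_atlas : set (triv vb_fiber vb_rank);
  vb_cover : forall p, exists2 t, vb_atlas t & triv_dom t p;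
  vb_compat : forall s t, vb_atlas s -> vb_atlas t -> forall i j,
    smooth_on (triv_dom s `&` triv_dom t)
      (fun p => triv_map t p (triv_inv s p (delta_mx 0 i)) 0 j)
}.

Definition smooth_section (R : realType) n (M : manifold R n) (E : vbundle M)
    (s : forall p, E p) : Prop :=
  forall t, vb_atlas t -> forall i,
    smooth_on (triv_dom t) (fun p => triv_map t p (s p) 0 i).

Record section (R : realType) n (M : manifold R n) (E : vbundle M) := MkSection {
  s_val :> forall p, E p;
  s_smooth : smooth_section s_val
}.

Section sections.
Variables (R : realType) (n : nat) (M : manifold R n) (E : vbundle M).
Local Notation C := (smooth_fun M).
Local Notation S := (section E).
Implicit Types (V W : S) (f g : C).

Lemma s_inj V W : (forall p, V p = W p) -> V = W.
Proof.
case: V W => V ? [W ?] /= VW.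
have {}VW : V = W by exact: functional_extensionality_dep.
subst W.
by congr MkSection; exact: Prop_irrelevance.
Qed.

HB.instance Definition _ := gen_eqMixin S.
HB.instance Definition _ := gen_choiceMixin S.

Let zeroP : smooth_section (fun p => 0 : E p).
Proof.
move=> t _ i; rewrite (_ : (fun _ => _) = cst 0); first exact: smooth_on_cst.
by apply/funext => p; rewrite linear0 mxE.
Qed.
Let addP V W : smooth_section (fun p => V p + W p).
Proof.
move=> t At i; have oU := @triv_dom_open _ _ _ _ _ t.
apply: smooth_on_ext (smooth_onD oU (s_smooth V At i) (s_smooth W At i)) => //.
by move=> p _; rewrite linearD mxE.
Qed.
Let scaleP f V : smooth_section (fun p => f p *: V p).
Proof.
move=> t At i; have oU := @triv_dom_open _ _ _ _ _ t.
have fs : smooth_on (triv_dom t) f by apply: smooth_on_sub (sf_smooth f).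
apply: smooth_on_ext (smooth_onM oU fs (s_smooth V At i)) => //.
by move=> p _; rewrite linearZ mxE.
Qed.

Definition s_zero : S := MkSection zeroP.
Definition s_add V W : S := MkSection (addP V W).
Definition s_scale f V : S := MkSection (scaleP f V).
Definition s_opp V : S := s_scale (- 1) V.

Let addA : associative s_add.
Proof. by move=> U V W; apply: s_inj => p; exact: addrA. Qed.
Let addC : commutative s_add.
Proof. by move=> V W; apply: s_inj => p; exact: addrC. Qed.
Let add0 : left_id s_zero s_add.
Proof. by move=> V; apply: s_inj => p; exact: add0r. Qed.
Let addN : left_inverse s_zero s_opp s_add.
Proof.
by move=> V; apply: s_inj => p; rewrite -[RHS](addNr (V p)) -scaleN1r.
Qed.

HB.instance Definition _ := GRing.isZmodule.Build S addA addC add0 addN.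

Let scaleA f g V : s_scale f (s_scale g V) = s_scale (f * g) V.
Proof. by apply: s_inj => p; exact: scalerA. Qed.
Let scale1 : left_id 1 s_scale.
Proof. by move=> V; apply: s_inj => p; exact: scale1r. Qed.
Let scaleDr : right_distributive s_scale +%R.
Proof. by move=> f V W; apply: s_inj => p; exact: scalerDr. Qed.
Let scaleDl V : {morph s_scale^~ V : f g / f + g}.
Proof. by move=> f g; apply: s_inj => p; exact: scalerDl. Qed.

HB.instance Definition _ :=
  GRing.Zmodule_isLmodule.Build C S scaleA scale1 scaleDr scaleDl.

Lemma sDE V W p : (V + W) p = V p + W p. Proof. by []. Qed.
Lemma sZE f V p : (f *: V) p = f p *: V p. Proof. by []. Qed.

End sections.

Record fiber_metric (R : realType) n (M : manifold R n) (E : vbundle M) :=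
  FiberMetric {
  fm_val :> forall p, E p -> E p -> R;
  fm_inner : forall p, inner_product (@fm_val p);
  fm_smooth : forall t, vb_atlas t -> forall i j,
    smooth_on (triv_dom t)
      (fun p => fm_val (triv_inv t p (delta_mx 0 i))
                       (triv_inv t p (delta_mx 0 j)))
}.
Arguments fm_val {R n M E} _ p _ _.

Section fiber_metric_app.
Variables (R : realType) (n : nat) (M : manifold R n) (E : vbundle M).
Variable g : fiber_metric E.

Lemma fm_suml p (I : Type) (r : seq I) (a : I -> R) (u : I -> E p) v :
  g p (\sum_(i <- r) a i *: u i) v = \sum_(i <- r) a i * g p (u i) v.
Proof.
have [lin _ _] := fm_inner g p.
elim: r => [|i r IH]; rewrite ?big_nil ?big_cons ?lin ?IH //.
by have := lin (-1) 0 0 v; rewrite scaler0 addr0 mulN1r addNr.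
Qed.

Lemma fm_sumr p (I : Type) (r : seq I) (a : I -> R) (u : I -> E p) v :
  g p v (\sum_(i <- r) a i *: u i) = \sum_(i <- r) a i * g p v (u i).
Proof.
have [_ sym _] := fm_inner g p.
by rewrite sym fm_suml; apply: eq_bigr => i _; rewrite sym.
Qed.

Lemma triv_decomp (t : triv E (vb_rank E)) p (v : E p) : triv_dom t p ->
  v = \sum_i triv_map t p v 0 i *: triv_inv t p (delta_mx 0 i).
Proof.
move=> tp; rewrite -[LHS](triv_mapK tp) {1}[triv_map t p v]row_sum_delta.
by rewrite linear_sum; apply: eq_bigr => i _; rewrite linearZ.
Qed.

Lemma fm_app_smooth (V W : section E) :
  smooth_on setT (fun p => g p (V p) (W p)).
Proof.
apply: smooth_on_local => p _; have [t At tp] := vb_cover E p.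
exists (triv_dom t) => //; rewrite setTI.
apply: (smooth_on_ext (f := fun p => \sum_i \sum_j
  triv_map t p (V p) 0 i * (triv_map t p (W p) 0 j *
  g p (triv_inv t p (delta_mx 0 i)) (triv_inv t p (delta_mx 0 j))))).
- exact: triv_dom_open.
- move=> q tq; rewrite [in RHS](triv_decomp (V q) tq).
  rewrite [in RHS](triv_decomp (W q) tq) fm_suml; apply: eq_bigr => i _.
  by rewrite fm_sumr mulr_sumr.
- have oU := @triv_dom_open _ _ _ _ _ t.
  apply: smooth_on_sum => // i; apply: smooth_on_sum => // j.
  by do 2!(apply: smooth_onM => //; first exact: s_smooth); exact: fm_smooth.
Qed.

Definition fm_app V W : smooth_fun M := SmoothFun (fm_app_smooth V W).

End fiber_metric_app.

Section hom_bundle.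
Variables (R : realType) (n : nat) (M : manifold R n) (E1 E2 : vbundle M).
Local Notation r1 := (vb_rank E1).
Local Notation r2 := (vb_rank E2).

Definition hom_fiber (p : M) : vectType R := 'Hom(E1 p, E2 p).

Section hom_triv.
Variables (t1 : triv E1 r1) (t2 : triv E2 r2).

Definition hom_triv_map p (L : hom_fiber p) : 'rV[R]_(r1 * r2) :=
  mxvec (lin1_mx (triv_map t2 p \o (L : 'Hom(E1 p, E2 p)) \o triv_inv t1 p)).
Definition hom_triv_inv p (A : 'rV[R]_(r1 * r2)) : hom_fiber p :=
  linfun (triv_inv t2 p \o mulmxr (vec_mx A) \o triv_map t1 p).

Lemma hom_triv_map_linear p : linear (@hom_triv_map p).
Proof.
move=> a K L; rewrite /hom_triv_map -linearP; congr mxvec.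
apply/matrixP => i j; rewrite !mxE /= lfunE /= lfunE /=.
by rewrite linearP !mxE.
Qed.
HB.instance Definition _ p := GRing.isLinear.Build R (hom_fiber p)
  'rV[R]_(r1 * r2) _ (@hom_triv_map p) (@hom_triv_map_linear p).

Lemma hom_triv_inv_linear p : linear (@hom_triv_inv p).
Proof.
move=> a A B; apply/lfunP => v; rewrite lfunE /= lfunE /= lfunE /=.
rewrite !lfunE /= -linearP; congr (triv_inv _ _ _).
by rewrite linearP mulmxDr -scalemxAr.
Qed.
HB.instance Definition _ p := GRing.isLinear.Build R 'rV[R]_(r1 * r2)
  (hom_fiber p) _ (@hom_triv_inv p) (@hom_triv_inv_linear p).

Lemma hom_triv_mapK p : triv_dom t1 p /\ triv_dom t2 p ->
  cancel (@hom_triv_map p) (@hom_triv_inv p).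
Proof.
move=> [p1 p2] L; apply/lfunP => v; rewrite lfunE /= mxvecK mul_rV_lin1 /=.
by rewrite !triv_mapK.
Qed.

Lemma hom_triv_invK p : triv_dom t1 p /\ triv_dom t2 p ->
  cancel (@hom_triv_inv p) (@hom_triv_map p).
Proof.
move=> [p1 p2] A; apply: (can_inj vec_mxK); rewrite mxvecK.
by apply/row_matrixP => i; rewrite rowE mul_rV_lin1 /= lfunE /= !triv_invK // -rowE.
Qed.

Definition hom_triv : triv hom_fiber (r1 * r2) :=
  @Triv _ _ _ hom_fiber _ (triv_dom t1 `&` triv_dom t2)
    (openI (@triv_dom_open _ _ _ _ _ t1) (@triv_dom_open _ _ _ _ _ t2))
    (fun p => @hom_triv_map p) (fun p => @hom_triv_inv p)
    hom_triv_mapK hom_triv_invK.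

End hom_triv.

Definition hom_atlas : set (triv hom_fiber (r1 * r2)) :=
  [set t | exists t1 t2, [/\ vb_atlas t1, vb_atlas t2 & t = hom_triv t1 t2]].

Lemma hom_cover p : exists2 t, hom_atlas t & triv_dom t p.
Proof.
have [t1 A1 p1] := vb_cover E1 p; have [t2 A2 p2] := vb_cover E2 p.
by exists (hom_triv t1 t2) => //; exists t1, t2.
Qed.

Lemma hom_compat s t : hom_atlas s -> hom_atlas t -> forall i j,
  smooth_on (triv_dom s `&` triv_dom t)
    (fun p => triv_map t p (triv_inv s p (delta_mx 0 i)) 0 j).
Proof.
move=> [s1 [s2 [As1 As2 ->]]] [t1 [t2 [At1 At2 ->]]] k l.
case/mxvec_indexP: k => i j; case/mxvec_indexP: l => a b /=.
rewrite (_ : (fun _ => _) =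
  (fun p => triv_map s1 p (triv_inv t1 p (delta_mx 0 a)) 0 i) *
  (fun p => triv_map t2 p (triv_inv s2 p (delta_mx 0 j)) 0 b)).
  apply: smooth_onM.
  - by do !apply: openI; exact: triv_dom_open.
  - by apply: smooth_on_sub (vb_compat At1 As1 a i) => p [[] ? ? []].
  - by apply: smooth_on_sub (vb_compat As2 At2 j b) => p [[] ? ? []].
apply/funext => p; rewrite mxvecE mxE /= lfunE /= vec_mx_delta.
have -> (u : 'rV[R]_r1) : u *m delta_mx i j = u 0 i *: delta_mx 0 j.
  apply/rowP => m; rewrite !mxE (bigD1 i) //= big1 => [|k /negPf ki];
    by rewrite !mxE ?eqxx ?ki ?andbF ?mulr0 ?addr0.
by rewrite !linearZ /= mxE.
Qed.

Definition hom_bundle : vbundle M := VBundle hom_cover hom_compat.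

Definition hom_at (F : section hom_bundle) (p : M) : 'Hom(E1 p, E2 p) := F p.

Lemma hom_app_smooth (F : section hom_bundle) (V : section E1) :
  smooth_section (fun p => hom_at F p (V p)).
Proof.
move=> t2 A2 b; apply: smooth_on_local => p tp.
have [t1 A1 tp1] := vb_cover E1 p.
exists (triv_dom t1) => //.
have oU : open (triv_dom t2 `&` triv_dom t1).
  by apply: openI; exact: triv_dom_open.
apply: (smooth_on_ext (f := fun p => \sum_a triv_map t1 p (V p) 0 a *
   triv_map (hom_triv t1 t2) p (F p) 0 (mxvec_index a b))) => //.
  move=> q [q2 q1]; rewrite {2}(triv_decomp (V q) q1) !linear_sum summxE.
  apply: eq_bigr => a _ /=; rewrite mxvecE mxE /=.
  by rewrite [hom_at F q _]linearZ linearZ mxE.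
apply: smooth_on_sum => // a; apply: smooth_onM => //.
  by apply: smooth_on_sub (s_smooth V A1 a) => q [].
have A12 : hom_atlas (hom_triv t1 t2) by exists t1, t2.
by apply: smooth_on_sub (s_smooth F (t := hom_triv t1 t2) A12 _) => q [].
Qed.

Definition hom_app (F : section hom_bundle) (V : section E1) : section E2 :=
  MkSection (hom_app_smooth F V).

End hom_bundle.

Record connection (R : realType) n (M : manifold R n) (E : vbundle M) :=
  Connection {
  nabla :> vector_field M -> section E -> section E;
  nablaDl : forall X Y V, nabla (X + Y) V = nabla X V + nabla Y V;
  nablaZl : forall f X V, nabla (f *: X) V = f *: nabla X V;
  nablaDr : forall X V W, nabla X (V + W) = nabla X V + nabla X W;
  nabla_leibniz : forall X f V,
    nabla X (f *: V) = vf_app X f *: V + f *: nabla X V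
}.

(* Also called compatibility of D with the fiber metric.  For connections that
   are not compatible, recurrent sections need not be semi-parallel: on the
   trivial line bundle over the plane take d for D1, d + x dy for D2 and the
   identity for F. *)
Definition metric_connection (R : realType) n (M : manifold R n)
    (E : vbundle M) (g : fiber_metric E) (D : connection E) : Prop :=
  forall X V W, vf_app X (fm_app g V W) = fm_app g (D X V) W + fm_app g V (D X W).

Definition curvature (R : realType) n (M : manifold R n) (A : zmodType)
    (D : vector_field M -> A -> A) (X Y : vector_field M) (a : A) : A :=
  D X (D Y a) - D Y (D X a) - D (lie X Y) a.

Section recurrent.
Variables (R : realType) (n : nat) (M : manifold R n) (E1 E2 : vbundle M).
Variables (D1 : connection E1) (D2 : connection E2).

(* Here Gamma(Hom(E1, E2)) is identified, through hom_app, with the maps from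
   Gamma(E1) to Gamma(E2) that are linear over smooth functions; nabla_hom_lin
   shows that these are preserved. *)
Definition nabla_hom (X : vector_field M) (T : section E1 -> section E2) :
    section E1 -> section E2 :=
  fun V => D2 X (T V) - T (D1 X V).

Lemma nabla_hom_lin X T :
  (forall f V W, T (f *: V + W) = f *: T V + T W) ->
  forall f V W,
    nabla_hom X T (f *: V + W) = f *: nabla_hom X T V + nabla_hom X T W.
Proof.
move=> linT f V W; rewrite /nabla_hom linT !nablaDr !nabla_leibniz.
have -> : T (vf_app X f *: V + f *: D1 X V + D1 X W) =
    vf_app X f *: T V + f *: T (D1 X V) + T (D1 X W).
  by rewrite -!addrA !linT.
rewrite scalerBr 2!opprD addrACA; congr (_ + _).
by rewrite addrACA subrr add0r.
Qed.

Lemma hom_app_lin (F : section (hom_bundle E1 E2)) f V W :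
  hom_app F (f *: V + W) = f *: hom_app F V + hom_app F W.
Proof. by apply: s_inj => p; exact: (linearP (hom_at F p)). Qed.

Lemma curvature_homE (F : section (hom_bundle E1 E2)) X Y V :
  curvature nabla_hom X Y (hom_app F) V =
  curvature D2 X Y (hom_app F V) - hom_app F (curvature D1 X Y V).
Proof.
have FB U W : hom_app F (U - W) = hom_app F U - hom_app F W.
  by rewrite addrC -scaleN1r hom_app_lin scaleN1r addrC.
have DN U Z : D2 Z (- U) = - D2 Z U.
  by apply/eqP; rewrite -addr_eq0 -nablaDr addNr; apply/eqP;
    apply: (addrI (D2 Z 0)); rewrite -nablaDr !addr0.
have DB U W Z : D2 Z (U - W) = D2 Z U - D2 Z W by rewrite nablaDr DN.
rewrite /curvature !FB.
transitivity (nabla_hom X (nabla_hom Y (hom_app F)) V -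
  nabla_hom Y (nabla_hom X (hom_app F)) V - nabla_hom (lie X Y) (hom_app F) V).
  by [].
rewrite /nabla_hom !DB !opprB ?opprD ?opprK !addrA.
by rewrite [LHS](ACl (1*8*10*9*3*6*5*2*7*4))/= !addrK.
Qed.

Definition recurrent (F : section (hom_bundle E1 E2)) : Prop :=
  exists tau : one_form M, forall X V,
    nabla_hom X (hom_app F) V = of_app tau X *: hom_app F V.

Definition semi_parallel (F : section (hom_bundle E1 E2)) : Prop :=
  forall X Y V, curvature nabla_hom X Y (hom_app F) V = 0.

End recurrent.

(* Main.v *)
Require Import Defs.
From mathcomp Require Import all_boot all_order all_algebra.
From mathcomp Require Import all_classical all_reals topology normedtype derive.
From mathcomp Require Import ring.
Set Implicit Arguments.
Unset Strict Implicit.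
Unset Printing Implicit Defensive.
Import Order.TTheory GRing.Theory Num.Theory.
Local Open Scope classical_set_scope.
Local Open Scope ring_scope.

(** A recurrent section satisfies R(X, Y) F = c F, where
    c = d tau (X, Y) is a smooth function, so it is enough to show that at
    each point p the product c F is 0.  Put A = F p and let R1, R2 be the
    curvatures of the two connections at p.  The action of the curvature on F
    also reads R2 A - A R1 = c A.  Since both connections are metric, R1 and R2
    are skew-symmetric; pairing with A v removes R2 and leaves
    c |A v|^2 = - <A R1 v, A v>.  Summing over an orthonormal basis, the right
    hand side becomes the trace of the product of the skew-symmetric R1 and
    the symmetric A^* A, which is 0.  Hence c |A|^2 = 0 for the
    Hilbert-Schmidt norm |A|, that is, c A = 0.

    The argument is run on the space of the values at p of global sections of
    E1, represented by the sections themselves, on which the curvature acts by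
    its definition. *)

Section inner_products.
Context {R : realType} {E : lmodType R} {g : E -> E -> R}.
Hypothesis ip : inner_product g.

Lemma ipC u v : g u v = g v u.
Proof. by have [] := ip. Qed.

Lemma ipDl u v w : g (u + v) w = g u w + g v w.
Proof. by have [lin _ _] := ip; rewrite -[u]scale1r lin mul1r scale1r. Qed.

Lemma ip0l w : g 0 w = 0.
Proof. by apply: (addrI (g 0 w)); rewrite -ipDl !addr0. Qed.

Lemma ipZl a u w : g (a *: u) w = a * g u w.
Proof. by have [lin _ _] := ip; rewrite -[a *: u]addr0 lin ip0l addr0. Qed.

Lemma ipNl u w : g (- u) w = - g u w.
Proof. by rewrite -scaleN1r ipZl mulN1r. Qed.

Lemma ipDr u v w : g u (v + w) = g u v + g u w.
Proof. by rewrite ipC ipDl !(ipC u). Qed.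

Lemma ipZr a u w : g u (a *: w) = a * g u w.
Proof. by rewrite ipC ipZl ipC. Qed.

Lemma ipNr u w : g u (- w) = - g u w.
Proof. by rewrite ipC ipNl ipC. Qed.

Lemma ip_suml (I : finType) (f : I -> E) w :
  g (\sum_i f i) w = \sum_i g (f i) w.
Proof. by apply: (big_morph (g^~ w)) => [u v|]; rewrite ?ipDl ?ip0l. Qed.

Lemma ip_gt0 u : u != 0 -> 0 < g u u.
Proof. by have [_ _] := ip; exact. Qed.

Lemma ip_eq0 u : (g u u == 0) = (u == 0).
Proof.
apply/eqP/eqP => [guu|->]; last exact: ip0l.
by apply/eqP; apply: contraTT isT => /ip_gt0; rewrite guu ltxx.
Qed.

Lemma ip_ge0 u : 0 <= g u u.
Proof. by have [->|/ip_gt0/ltW//] := eqVneq u 0; rewrite ip0l. Qed.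

Definition orthonormal k (e : 'I_k -> E) : Prop :=
  forall i j, g (e i) (e j) = (i == j)%:R.

Lemma orthonormal_coef k (e : 'I_k -> E) (a : 'I_k -> R) j :
  orthonormal e -> g (\sum_i a i *: e i) (e j) = a j.
Proof.
move=> oe; rewrite ip_suml (bigD1 j) //= big1 => [|i /negPf ij].
  by rewrite ipZl oe eqxx mulr1 addr0.
by rewrite ipZl oe ij mulr0.
Qed.

End inner_products.
Arguments orthonormal {R E} g {k} e.

Lemma orthonormal_leq_dim (R : realType) (E : vectType R) (g : E -> E -> R)
    k (e : 'I_k -> E) :
  inner_product g -> orthonormal g e -> (k <= \dim {:E})%N.
Proof.
move=> ip oe; suff fe : free [tuple e i | i < k].
  move: fe; rewrite /free size_tuple => /eqP <-.
  exact: dimvS (subvf _).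
apply/freeP => a a0 i.
have {}a0 : \sum_j a j *: e j = 0.
  by rewrite -[RHS]a0; apply: eq_bigr => j _; rewrite -tnth_nth tnth_mktuple.
by rewrite -(orthonormal_coef ip a i oe) a0 (ip0l ip).
Qed.

(** Subspaces of [E] are presented as ranges of maps [ev], and their bases as
    families in the source of [ev]: this is the form in which the values of
    sections at a point occur.  A largest orthonormal family spans, because
    otherwise the normalized residue of some vector would extend it. *)
Lemma orthonormal_basis (R : realType) (E : vectType R) (g : E -> E -> R)
    (S : Type) (ev : S -> E) :
  inner_product g ->
  (forall a V W, exists U, ev U = a *: ev V + ev W) ->
  exists k (e : 'I_k -> S), orthonormal g (ev \o e) /\
    forall V, ev V = \sum_i g (ev V) (ev (e i)) *: ev (e i).
Proof.
move=> ip lin.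
pose Q k := `[< exists e : 'I_k -> S, orthonormal g (ev \o e) >].
have Q0 : exists k, Q k.
  have e0 : 'I_0 -> S by case.
  by exists 0%N; apply/asboolP; exists e0; case.
have Qb k : Q k -> (k <= \dim {:E})%N.
  by move=> /asboolP[e]; exact: orthonormal_leq_dim.
case: (ex_maxnP Q0 Qb) => k /asboolP[e oe] kmax.
exists k, e; split => // V; apply/eqP/negP => Vne.
have sumP (a : 'I_k -> R) : exists U, ev U = ev V - \sum_i a i *: ev (e i).
  rewrite -sumrN; elim/big_rec: _ => [|i v _ [U HU]].
    by exists V; rewrite addr0.
  have [W HW] := lin (- a i) (e i) U.
  by exists W; rewrite HW HU scaleNr addrCA.
have [U HU] := sumP (fun i => g (ev V) (ev (e i))).
have U0 : ev U != 0 by rewrite HU subr_eq0; apply/negP.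
have Uo i : g (ev U) (ev (e i)) = 0.
  rewrite HU (ipDl ip) (ipNl ip).
  by rewrite (orthonormal_coef ip (fun i => g (ev V) (ev (e i))) i oe) subrr.
(* Z evaluates to 0, which turns the closure hypothesis into closure under
   scaling; N is the normalized residue. *)
have [Z HZ] := lin (-1) U U.
have [N HN] := lin (Num.sqrt (g (ev U) (ev U)))^-1 U Z.
rewrite HZ scaleN1r addNr addr0 in HN.
have NN : g (ev N) (ev N) = 1.
  rewrite HN (ipZl ip) (ipZr ip) mulrA -invfM -expr2 sqr_sqrtr ?ip_ge0 //.
  by rewrite mulVf // (ip_eq0 ip).
have No i : g (ev N) (ev (e i)) = 0 by rewrite HN (ipZl ip) Uo mulr0.
suff /kmax : Q k.+1 by rewrite ltnn.
apply/asboolP; exists (fun i => oapp e N (unlift ord0 i)) => i j.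
case: (unliftP ord0 i) => [i'|] ->; case: (unliftP ord0 j) => [j'|] -> /=;
  rewrite ?liftK ?unlift_none /=.
- by rewrite (inj_eq lift_inj) -oe.
- by rewrite (ipC ip) No.
- by rewrite No.
- by rewrite NN.
Qed.

(** Summing the hypothesis on [c] over an orthonormal basis gives c |A|^2 on
    the left, and on the right the trace of rho (A^* A), that is, the sum of
    the products of entries of a skew-symmetric and a symmetric matrix.  The
    map [rho] acts on [S], as the curvature does on sections; expanding
    [ev (rho V)] in the basis uses only its matrix of inner products. *)
Lemma skew_trace0 (R : realType) (E1 E2 : vectType R)
    (g1 : E1 -> E1 -> R) (g2 : E2 -> E2 -> R) (S : Type) (ev : S -> E1)
    (rho : S -> S) (A : {linear E1 -> E2}) (c : R) :
  inner_product g1 -> inner_product g2 ->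
  (forall a V W, exists U, ev U = a *: ev V + ev W) ->
  (forall V W, g1 (ev (rho V)) (ev W) = - g1 (ev V) (ev (rho W))) ->
  (forall V, c * g2 (A (ev V)) (A (ev V)) =
             g2 (A (ev (rho V))) (A (ev V))) ->
  forall V, c *: A (ev V) = 0.
Proof.
move=> ip1 ip2 lin skew cA.
have [k [e [oe decomp]]] := orthonormal_basis ip1 lin.
pose a i j := g1 (ev (rho (e i))) (ev (e j)).
pose h i j := g2 (A (ev (e i))) (A (ev (e j))).
have aN i j : a i j = - a j i by rewrite /a skew (ipC ip1).
have hC i j : h i j = h j i by rewrite /h (ipC ip2).
have ch i : c * h i i = \sum_j a i j * h j i.
  rewrite /h cA [in LHS]decomp linear_sum (ip_suml ip2).
  by apply: eq_bigr => j _; rewrite linearZ (ipZl ip2).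
have tr0 : \sum_i \sum_j a i j * h j i = 0.
  set t := LHS; suff tN : t = - t.
    by apply/eqP; rewrite -eqNr -tN eqxx.
  rewrite {1}/t exchange_big -sumrN; apply: eq_bigr => i _ /=.
  by rewrite -sumrN; apply: eq_bigr => j _; rewrite aN hC mulNr.
move=> V; have [->|c0] := eqVneq c 0; first by rewrite scale0r.
have h0 : \sum_i h i i = 0.
  apply: (mulfI c0); rewrite mulr0 mulr_sumr -[RHS]tr0.
  by apply: eq_bigr => i _.
have Ae i : A (ev (e i)) = 0.
  apply/eqP; rewrite -(ip_eq0 ip2); apply/eqP.
  by apply: (psumr_eq0P _ h0) => // j _; exact: ip_ge0.
rewrite decomp linear_sum big1 ?scaler0 // => i _.
by rewrite linearZ Ae /= scaler0.
Qed.

Lemma sNE (R : realType) n (M : manifold R n) (E : vbundle M)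
  (V : section E) p : (- V) p = - V p.
Proof. exact: scaleN1r. Qed.

(** Differentiating <V, W> along [X, Y] and along X Y - Y X gives the same;
    the mixed terms <D_X V, D_Y W> cancel. *)
Lemma metric_curvature_skew (R : realType) n (M : manifold R n) (E : vbundle M)
    (g : fiber_metric E) (D : connection E) X Y (V W : section E) p :
  metric_connection g D ->
  g p (curvature D X Y V p) (W p) = - g p (V p) (curvature D X Y W p).
Proof.
move=> gD; have ip := fm_inner g p.
have second Z Z' : vf_app Z (vf_app Z' (fm_app g V W)) p =
    g p (D Z (D Z' V) p) (W p) + g p (D Z' V p) (D Z W p) +
    (g p (D Z V p) (D Z' W p) + g p (V p) (D Z (D Z' W) p)).
  by rewrite gD vf_appD !gD.
have : vf_app (lie X Y) (fm_app g V W) p =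
    vf_app X (vf_app Y (fm_app g V W)) p - vf_app Y (vf_app X (fm_app g V W)) p.
  by [].
rewrite !second gD /curvature sfDE !sDE !sNE /=.
rewrite !(ipDl ip) !(ipNl ip) !(ipDr ip) !(ipNr ip).
move=> H; apply/eqP; rewrite -subr_eq0; apply/eqP.
move: H => /eqP; rewrite -subr_eq0 => /eqP H.
by rewrite -[RHS]oppr0 -H; ring.
Qed.

Definition one_form_d {R : realType} {n} {M : manifold R n} (tau : one_form M)
    (X Y : vector_field M) : smooth_fun M :=
  vf_app X (of_app tau Y) - vf_app Y (of_app tau X) - of_app tau (lie X Y).

(** The second derivative of F along X and Y is
    X (tau Y) F + tau X tau Y F, whose second term is symmetric in X and Y. *)
Lemma recurrent_curvature (R : realType) n (M : manifold R n)
    (E1 E2 : vbundle M) (D1 : connection E1) (D2 : connection E2)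
    (F : section (hom_bundle E1 E2)) (tau : one_form M) X Y V :
  (forall X V, nabla_hom D1 D2 X (hom_app F) V = of_app tau X *: hom_app F V) ->
  curvature (nabla_hom D1 D2) X Y (hom_app F) V =
    one_form_d tau X Y *: hom_app F V.
Proof.
move=> rec.
have second Z Z' :
    nabla_hom D1 D2 Z (nabla_hom D1 D2 Z' (hom_app F)) V =
    vf_app Z (of_app tau Z') *: hom_app F V +
    of_app tau Z' *: (of_app tau Z *: hom_app F V).
  rewrite {1}/nabla_hom !rec nabla_leibniz -addrA -scalerBr; congr (_ + _).
  by congr (_ *: _); exact: rec.
transitivity (nabla_hom D1 D2 X (nabla_hom D1 D2 Y (hom_app F)) V -
  nabla_hom D1 D2 Y (nabla_hom D1 D2 X (hom_app F)) V -
  nabla_hom D1 D2 (lie X Y) (hom_app F) V) => //.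
rewrite !second rec /one_form_d !scalerBl; congr (_ - _).
by rewrite !scalerA [of_app tau X * _]mulrC opprD addrACA subrr addr0.
Qed.

Theorem lemma5p1 (R : realType) (n : nat) (M : manifold R n)
    (gM : riemannian_metric M)
    (E1 E2 : vbundle M) (g1 : fiber_metric E1) (g2 : fiber_metric E2)
    (D1 : connection E1) (D2 : connection E2)
    (F : section (hom_bundle E1 E2)) :
  connected [set: M] ->
  metric_connection g1 D1 -> metric_connection g2 D2 ->
  recurrent D1 D2 F -> semi_parallel D1 D2 F.
Proof.
move=> _ metric1 metric2 [tau rec] X Y V.
have curvF W : one_form_d tau X Y *: hom_app F W =
    curvature D2 X Y (hom_app F W) - hom_app F (curvature D1 X Y W).
  by rewrite -curvature_homE (recurrent_curvature _ _ _ rec).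
rewrite (recurrent_curvature _ _ _ rec); apply: s_inj => p.
have ip2 := fm_inner g2 p.
(* The trace identity applies to the negative of the recurrence factor: the
   term in R1 enters the commutator with a minus sign. *)
rewrite sZE -[LHS]opprK -scaleNr -[RHS]oppr0; congr (- _).
apply: (skew_trace0 (ev := fun W : section E1 => W p)
  (rho := curvature D1 X Y) (A := hom_at F p) (fm_inner g1 p) ip2).
- by move=> a U W; exists (sf_cst M a *: U + W).
- by move=> U W; exact: metric_curvature_skew.
move=> W.
have /(congr1 (fun U : section E2 => g2 p (U p) (hom_at F p (W p)))) := curvF W.
have skew2 : g2 p (curvature D2 X Y (hom_app F W) p) (hom_at F p (W p)) = 0.
  set t := LHS; suff tN : t = - t.
    by apply/eqP; rewrite -eqNr -tN eqxx.
  rewrite {1}/t (metric_curvature_skew X Y _ (hom_app F W) p metric2).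
  by rewrite (ipC ip2).
rewrite sZE sDE sNE (ipZl ip2) (ipDl ip2) (ipNl ip2) skew2 sub0r.
by rewrite mulNr => ->; rewrite opprK.
Qed.
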